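(* Let $R$ be a ring and let $\zeta: Q_0\to Q_1$ be an $R$-homomorphism between injective right $R$-modules, with $T=\operatorname{Ker}\zeta$. Then $T$ is a cosilting module in $\operatorname{Mod} R$ with respect to $\zeta$ (that is, $\operatorname{Cogen} T=\mathcal{B}_\zeta$) if and only if there exists a right ideal $I$ of $R$ such that the following three conditions hold: (1) $T$ is a cotilting object in $\sigma[R/I]$, with the injective coresolution (short exact sequence in $\sigma[R/I]$) $$0\longrightarrow T\longrightarrow \operatorname{Tr}_{R/I}(Q_0)\xrightarrow{\operatorname{Tr}_{R/I}(\zeta)}\operatorname{Tr}_{R/I}(Q_1)\longrightarrow 0;$$ (2) $\operatorname{Ext}^1_{\sigma[R/I]}(R/I,T)=0$; (3) $I\in\operatorname{Ker}\operatorname{Hom}_R(-,\mathcal{B}_\zeta)$, i.e. $\operatorname{Hom}_R(I,Y)=0$ for every $Y\in\mathcal{B}_\zeta$.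
   Context: $R$ is a ring with unit and $\operatorname{Mod} R$ is the category of right $R$-modules. For an $R$-homomorphism $\zeta:Q_0\to Q_1$, $\mathcal{B}_\zeta=\{X\in\operatorname{Mod} R \mid \operatorname{Hom}_R(X,\zeta):\operatorname{Hom}_R(X,Q_0)\to\operatorname{Hom}_R(X,Q_1)\text{ is surjective}\}$. $\operatorname{Cogen} T$ is the class of all right $R$-modules that embed into a direct product $T^\Lambda$ of copies of $T$ in $\operatorname{Mod} R$, for some set $\Lambda$. A module $T$ is cosilting with respect to $\zeta$ if there is an exact sequence $0\to T\to Q_0\xrightarrow{\zeta}Q_1$ with $Q_0,Q_1$ injective and $\operatorname{Cogen} T=\mathcal{B}_\zeta$. For a right $R$-module $M$, $\sigma[M]$ is the full subcategory of $\operatorname{Mod} R$ whose objects are the submodules of $M$-generated modules (an $M$-generated module is a quotient of a direct sum of copies of $M$). It is a Grothendieck category with enough injectives and has arbitrary products; products in $\sigma[M]$ need not agree with products in $\operatorname{Mod} R$. $\operatorname{Tr}_M(L)=\sum\{\operatorname{Im} f\mid f\in\operatorname{Hom}_R(M,L)\}\subseteq L$ is the trace of $M$ in $L$. For $\zeta:L\to X$, $\operatorname{Tr}_M(\zeta):\operatorname{Tr}_M(L)\to\operatorname{Tr}_M(X)$ is the restriction of $\zeta$. If $W$ is injective in $\operatorname{Mod} R$, then $\operatorname{Tr}_M(W)$ is an injective object of $\sigma[M]$. In the displayed sequence the first map is the inclusion of $T=\operatorname{Ker}\zeta\subseteq Q_0$ with image in $\operatorname{Tr}_{R/I}(Q_0)$.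 For an abelian category $\mathcal{A}$, $\operatorname{Ext}^i_{\mathcal{A}}$ denotes the Yoneda extension group. If products of copies of $T$ exist in $\mathcal{A}$, $\operatorname{Cogen}_{\mathcal{A}}T$ is the class of objects of $\mathcal{A}$ that embed into a product of copies of $T$, the product being taken in $\mathcal{A}$. $T$ is a cotilting object in $\mathcal{A}$ if $\operatorname{Cogen}_{\mathcal{A}}T=\operatorname{Ker}\operatorname{Ext}^1_{\mathcal{A}}(-,T)=\{X\in\mathcal{A}\mid\operatorname{Ext}^1_{\mathcal{A}}(X,T)=0\}$. *)

(* Defs.v *)
From HB Require Import structures.
From mathcomp Require Import all_boot all_order all_algebra.
From mathcomp Require Import boolp classical_sets functions cardinality.

Set Implicit Arguments.
Unset Strict Implicit.
Unset Printing Implicit Defensive.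

Import GRing.Theory.
Local Open Scope ring_scope.
Local Open Scope quotient_scope.

(* Everything is developed for the left modules over a ring A; right modules  *)
(* over R are the case A = R^c, with R_R = (R^c)^o, where a *: x is x * a     *)
(* computed in R. The submodules of (R^c)^o are the right ideals of R.        *)

Section Submodule.
Variables (A : pzRingType) (V : lmodType A) (S : submodClosed V).

Record submod := Submod { submod_val : V; _ : submod_val \in S }.

HB.instance Definition _ := [isSub for submod_val].
HB.instance Definition _ := [Choice of submod by <:].
HB.instance Definition _ := [SubChoice_isSubLmodule of submod by <:].

End Submodule.

Section QuotientModule.
Variables (A : pzRingType) (V : lmodType A) (S : submodClosed V).

(* submodClosed does not record closure under opposite, which {ideal_quot _} needs. *)
Definition submod_zmod : {pred V} := fun x => x \in S.

Lemma submod_zmod_closed : zmod_closed submod_zmod.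
Proof.
have [S0 SB] := submodClosedP S; split=> [|x y Sx Sy]; first exact: S0.
by have := SB (-1) y x Sy Sx; rewrite scaleN1r addrC.
Qed.

HB.instance Definition _ :=
  GRing.isZmodClosed.Build V submod_zmod submod_zmod_closed.

Definition quotmod := {ideal_quot submod_zmod}.
HB.instance Definition _ := GRing.Zmodule.on quotmod.

Definition quotmod_pi (x : V) : quotmod := \pi_{ideal_quot submod_zmod} x.

Definition quotmod_scale (a : A) (u : quotmod) : quotmod :=
  quotmod_pi (a *: repr (u : {ideal_quot submod_zmod})).

Lemma quotmod_piP x y : quotmod_pi x = quotmod_pi y <-> x - y \in S.
Proof.
rewrite -[x - y \in S]/(x - y \in submod_zmod) Quotient.idealrBE.
by split=> [e|/eqP //]; apply/eqP; exact: e.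
Qed.

Lemma quotmod_piD x y : quotmod_pi (x + y) = quotmod_pi x + quotmod_pi y.
Proof. exact: raddfD. Qed.

Lemma quotmod_piK (u : quotmod) :
  quotmod_pi (repr (u : {ideal_quot submod_zmod})) = u.
Proof. exact: reprK. Qed.

Lemma quotmod_piZ a x : quotmod_scale a (quotmod_pi x) = quotmod_pi (a *: x).
Proof.
rewrite /quotmod_scale; apply/quotmod_piP; rewrite -scalerBr.
by apply: rpredZ; apply/quotmod_piP; rewrite quotmod_piK.
Qed.

Lemma quotmod_scaleA a b u :
  quotmod_scale a (quotmod_scale b u) = quotmod_scale (a * b) u.
Proof. by rewrite -[u]quotmod_piK !quotmod_piZ scalerA. Qed.

Lemma quotmod_scale1 : left_id 1 quotmod_scale.
Proof. by move=> u; rewrite -[u]quotmod_piK quotmod_piZ scale1r. Qed.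

Lemma quotmod_scaleDr : right_distributive quotmod_scale +%R.
Proof.
move=> a u v; rewrite -[u]quotmod_piK -[v]quotmod_piK -quotmod_piD.
by rewrite !quotmod_piZ scalerDr quotmod_piD.
Qed.

Lemma quotmod_scaleDl u : {morph quotmod_scale^~ u : a b / a + b}.
Proof.
by move=> a b; rewrite -[u]quotmod_piK !quotmod_piZ scalerDl quotmod_piD.
Qed.

HB.instance Definition _ := GRing.Zmodule_isLmodule.Build A quotmod
  quotmod_scaleA quotmod_scale1 quotmod_scaleDr quotmod_scaleDl.

End QuotientModule.

Section Kernel.
Variables (A : pzRingType) (U V : lmodType A) (f : {linear U -> V}).

Definition lin_ker : {pred U} := fun x => f x == 0.

Lemma lin_ker_closed : submod_closed lin_ker.
Proof.
split=> [|a x y /eqP fx /eqP fy]; apply/eqP; first exact: linear0.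
by rewrite linearP fx fy scaler0 addr0.
Qed.

HB.instance Definition _ :=
  GRing.isSubmodClosed.Build A U lin_ker lin_ker_closed.

End Kernel.

Section Trace.
Variables (A : pzRingType) (M : lmodType A).

Definition trace (L : lmodType A) : {pred L} := fun x =>
  `[< exists s : seq ({linear M -> L} * M), x = \sum_(p <- s) p.1 p.2 >].
Arguments trace : clear implicits.

Section TraceClosed.
Variable L : lmodType A.

Lemma trace_closed : submod_closed (trace L).
Proof.
split; first by apply/asboolP; exists [::]; rewrite big_nil.
move=> a x y /asboolP[s ->] /asboolP[t ->]; apply/asboolP.
exists ([seq (p.1, a *: p.2) | p <- s] ++ t).
rewrite big_cat big_map scaler_sumr; congr (_ + _).
by apply: eq_bigr => p _; rewrite linearZ.
Qed.

HB.instance Definition _ :=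
  GRing.isSubmodClosed.Build A L (trace L) trace_closed.

End TraceClosed.

Section TraceMap.
Variables (L X : lmodType A) (z : {linear L -> X}).

Lemma trace_map_subproof (x : submod (trace L)) : z (val x) \in trace X.
Proof.
have /asboolP[s ->] := valP x; apply/asboolP.
exists [seq ((z \o p.1 : {linear M -> X}), p.2)
  | p : {linear M -> L} * M <- s].
by rewrite big_map linear_sum.
Qed.

Definition trace_map (x : submod (trace L)) : submod (trace X) :=
  Submod (trace_map_subproof x).

Lemma trace_map_linear : linear trace_map.
Proof. by move=> a x y; apply: val_inj; rewrite /= linearP. Qed.

HB.instance Definition _ := GRing.isLinear.Build A
  (submod (trace L)) (submod (trace X)) _ trace_map trace_map_linear.

End TraceMap.
End Trace.

Arguments trace {A} M L.
Arguments trace_map {A} M {L X} z x.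

Section DirectSum.
Variables (A : pzRingType) (I : Type) (M : lmodType A).

Definition fin_supp : {pred (I -> M)} := fun f =>
  `[< finite_set [set i | f i <> 0]%classic >].

Lemma fin_supp_closed : submod_closed fin_supp.
Proof.
split.
  apply/asboolP; rewrite (_ : mkset _ = set0) //.
  by rewrite -subset0 => i /=; apply.
move=> a f g /asboolP Ff /asboolP Fg; apply/asboolP.
apply: (@sub_finite_set _ _
  ([set i | f i <> 0] `|` [set i | g i <> 0])%classic); last first.
  by rewrite finite_setU.
move=> i /= fg; have [f0|f0] := pselect (f i = 0); last by left.
right=> g0; apply: fg.
by rewrite -[LHS]/(a *: f i + g i) f0 g0 scaler0 addr0.
Qed.

HB.instance Definition _ :=
  GRing.isSubmodClosed.Build A (I -> M) fin_supp fin_supp_closed.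

Definition dsum := submod fin_supp.
HB.instance Definition _ := GRing.Lmodule.on dsum.

End DirectSum.

Section Modules.
Variable A : pzRingType.
Implicit Types (C : lmodType A -> Prop) (M P Q T X Y : lmodType A).

Definition surjective (U V : Type) (f : U -> V) : Prop := forall y, exists x, f x = y.

Definition exact_at (U V W : lmodType A)
    (f : {linear U -> V}) (g : {linear V -> W}) : Prop :=
  forall y, g y = 0 <-> exists x, f x = y.

Definition short_exact (U V W : lmodType A)
    (f : {linear U -> V}) (g : {linear V -> W}) : Prop :=
  [/\ injective f, exact_at f g & surjective g].

(* A predicate C stands for the full subcategory of the modules satisfying    *)
(* it. The definitions below are used for all modules and for sigma M, which  *)
(* is closed under submodules and quotients: its monomorphisms, epimorphisms  *)
(* and exact sequences are the injections, the surjections and the exact      *)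
(* sequences of modules.                                                      *)

Definition all_modules : lmodType A -> Prop := fun=> True.

Definition injective_in C (Q : lmodType A) : Prop :=
  C Q /\
  forall X Y (i : {linear X -> Y}) (f : {linear X -> Q}),
    C X -> C Y -> injective i ->
    exists g : {linear Y -> Q}, forall x, g (i x) = f x.

Definition is_power_in C T (I : Type) P (p : I -> {linear P -> T}) : Prop :=
  C P /\
  forall Y (f : I -> {linear Y -> T}), C Y ->
    exists g : {linear Y -> P}, (forall i y, p i (g y) = f i y) /\
      forall h : {linear Y -> P}, (forall i y, p i (h y) = f i y) -> h =1 g.

Definition cogen_in C T X : Prop :=
  C X /\
  exists (I : Type) (P : lmodType A) (p : I -> {linear P -> T}),
    is_power_in C p /\ exists j : {linear X -> P}, injective j.

Definition Cogen T X : Prop :=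
  exists (I : Type) (j : {linear X -> (I -> T)}), injective j.

Record extension X T := Extension {
  ext_mid : lmodType A;
  ext_in : {linear T -> ext_mid};
  ext_out : {linear ext_mid -> X};
  _ : short_exact ext_in ext_out }.

(* Such a phi is always bijective. *)
Definition yoneda_eq X T (E F : extension X T) : Prop :=
  exists phi : {linear ext_mid E -> ext_mid F},
    (forall t, phi (ext_in E t) = ext_in F t) /\
    (forall e, ext_out F (phi e) = ext_out E e).

Section SplitExtension.
Variables X T : lmodType A.

Definition split_in (t : T) : T * X := (t, 0).
Definition split_out (u : T * X) : X := u.2.

Lemma split_in_linear : linear split_in.
Proof.
by move=> a x y; rewrite /split_in -[RHS]/(_, a *: 0 + 0) scaler0 addr0.
Qed.

Lemma split_out_linear : linear split_out.
Proof. by []. Qed.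

HB.instance Definition _ :=
  GRing.isLinear.Build A T (T * X)%type _ split_in split_in_linear.
HB.instance Definition _ :=
  GRing.isLinear.Build A (T * X)%type X _ split_out split_out_linear.

Lemma split_exact : short_exact split_in split_out.
Proof.
split=> [x y [//]|[t x]|x]; last by exists (0, x).
by split=> [/= ->|[u [_ <-]]] //; exists t.
Qed.

Definition split_extension : extension X T := Extension split_exact.

End SplitExtension.

(* The elements of the Yoneda group Ext^1_C(X, T) are the classes modulo      *)
(* yoneda_eq of the extensions with middle term in C, and the zero for the    *)
(* Baer sum is the class of the split extension.                              *)
Definition Ext1_eq0 C X T : Prop :=
  forall E : extension X T, C (ext_mid E) -> yoneda_eq E (split_extension X T).

Definition cotilting_in C T : Prop :=
  C T /\ forall X, cogen_in C T X <-> C X /\ Ext1_eq0 C X T.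

Definition Bclass Q0 Q1 (z : {linear Q0 -> Q1}) X : Prop :=
  forall g : {linear X -> Q1}, exists f : {linear X -> Q0},
    forall x, z (f x) = g x.

Definition cosilting Q0 Q1 (z : {linear Q0 -> Q1}) T : Prop :=
  [/\ injective_in all_modules Q0,
      injective_in all_modules Q1,
      exists i : {linear T -> Q0}, injective i /\ exact_at i z
    & forall X, Cogen T X <-> Bclass z X].

Definition generated_by M X : Prop :=
  exists (I : Type) (p : {linear dsum I M -> X}), surjective p.

Definition sigma M X : Prop :=
  exists (G : lmodType A) (j : {linear X -> G}), generated_by M G /\ injective j.

(* 0 -> Ker z -> Tr_M(Q0) -> Tr_M(Q1) -> 0, the first map being the inclusion *)
(* between these submodules of Q0.                                            *)
Definition trace_coresolution M Q0 Q1 (z : {linear Q0 -> Q1}) : Prop :=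
  [/\ injective_in (sigma M) (submod (trace M Q0)),
      injective_in (sigma M) (submod (trace M Q1))
    & exists i : {linear submod (lin_ker z) -> submod (trace M Q0)},
        (forall t, val (i t) = val t) /\
        short_exact i (trace_map M z)].

End Modules.

(* Main.v *)
From HB Require Import structures.
Require Import Defs.
From mathcomp Require Import all_boot all_order all_algebra.
From mathcomp Require Import boolp classical_sets functions cardinality fsbigop.

Set Implicit Arguments.
Unset Strict Implicit.
Unset Printing Implicit Defensive.

Import GRing.Theory.
Local Open Scope ring_scope.

(** Write T for the kernel of zeta and M for R/I. Under the three conditions,
    and also when T is cosilting and I is its annihilator, every module of
    Cogen T and of the class B of zeta is killed by I, in the sense that
    multiplication by an element of I is zero on it. For such modules the
    situations in Mod R and in sigma[M] agree.

    - A module killed by I lies in sigma[M], since each of its elements is the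
      image of 1 under a map from R/I ([killed_sigma]).
    - The powers of T are killed by I, so they are also the powers in sigma[M],
      and cogeneration by T means the same in both categories ([cogen_inP]).
    - For X in sigma[M], every map from X to an injective module Q lands in the
      trace of M in Q ([sigma_lin_trace]), so 0 -> T -> Tr Q0 -> Tr Q1 -> 0
      computes Ext^1(X, T) as the cokernel of Hom(X, Q0) -> Hom(X, Q1). Thus
      Ext^1(X, T) = 0 in sigma[M] exactly when X is in B ([Bclass_Ext1_eq0] and
      [Ext1_eq0_Bclass]).

    So, given the coresolution, T is cotilting in sigma[M] if and only if
    Cogen T = B ([cotilting_iff_cosilting]).

    If T is cosilting, let I be the annihilator of T. Then R/I embeds into a
    power of T, hence is in B, and lifting maps from R/I along zeta gives the
    surjectivity of Tr Q0 -> Tr Q1 ([trace_coresolution_of_Bclass]). The same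
    lifting extends each map I -> T to R ([hom_ann_eq0]); the extended map is
    of the form r |-> t r, which is zero on I, so Hom(I, T) = 0, and therefore
    Hom(I, Y) = 0 for all Y in Cogen T = B.

    Conversely, if Hom(I, Y) = 0 for all Y in B, then the maps r |-> y r show
    that such Y are killed by I ([killed_of_hom0]). This applies to T, which is
    cogenerated by itself and so is in B by the cotilting condition, and hence
    to all of Cogen T. *)

(** * Linear maps *)

Section LinearMaps.
Variable A : pzRingType.
Implicit Types U V W X Y : lmodType A.

(** Most maps below are given by a formula inside a proof, where no structure
    can be declared for them; hence the existential form, here and in the
    lemmas that follow. *)
Lemma linear_packP U V (f : U -> V) :
  linear f -> exists g : {linear U -> V}, g =1 f.
Proof.
move=> f_lin; pose L := GRing.isLinear.Build A U V *:%R f f_lin.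
by pose g : {linear U -> V} := HB.pack f L; exists g.
Qed.

Lemma factor_surjection U V W (e : {linear U -> V}) (h : {linear U -> W}) :
  surjective e -> (forall u, e u = 0 -> h u = 0) ->
  exists f : {linear V -> W}, forall u, f (e u) = h u.
Proof.
move=> /choice[s sK] h0.
have hE u v : e u = e v -> h u = h v.
  by move=> euv; apply/subr0_eq; rewrite -linearB h0 // linearB euv subrr.
have [|f fE] := @linear_packP V W (h \o s).
  by move=> a x y /=; rewrite -linearP; apply: hE; rewrite linearP !sK.
by exists f => u; rewrite fE; apply: hE; rewrite sK.
Qed.

Lemma corestrict X U (S : submodClosed U) (f : {linear X -> U}) :
  (forall x, f x \in S) ->
  exists g : {linear X -> submod S}, forall x, val (g x) = f x.
Proof.
move=> fS.
have [|g gE] := @linear_packP X (submod S) (fun x => Submod (fS x)).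
  by move=> a x y; apply: val_inj; rewrite /= linearP.
by exists g => x; rewrite gE.
Qed.

Lemma fct_lin X V (I : Type) (f : I -> {linear X -> V}) :
  exists g : {linear X -> (I -> V)}, forall i x, g x i = f i x.
Proof.
have [|g gE] := @linear_packP X (I -> V) (fun x i => f i x).
  by move=> a x y; apply/funext => i; rewrite linearP.
by exists g => i x; rewrite gE.
Qed.

Lemma fct_proj V (I : Type) (i : I) :
  exists p : {linear (I -> V) -> V}, forall u, p u = u i.
Proof.
by have [//|p pE] := @linear_packP (I -> V) V (fun u => u i); exists p.
Qed.

(** The isomorphism Hom(A, V) = V, which turns elements into maps from A. *)
Lemma orbit_lin V (v : V) : exists f : {linear A^o -> V}, forall a : A, f a = a *: v.
Proof.
have [|f fE] := @linear_packP A^o V (fun a : A => a *: v); last by exists f.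
by move=> a x y; rewrite scalerDl -scalerA.
Qed.

Lemma quotmod_pi_lin V (S : submodClosed V) :
  exists p : {linear V -> quotmod S},
    surjective p /\ forall x, p x = 0 <-> x \in S.
Proof.
have [|p pE] := @linear_packP V (quotmod S) (quotmod_pi S).
  by move=> a x y; rewrite quotmod_piD -quotmod_piZ.
exists p; split=> [u|x].
  by exists (repr (u : {ideal_quot submod_zmod S})); rewrite pE quotmod_piK.
by rewrite -[0](linear0 p) !pE quotmod_piP subr0.
Qed.

Lemma linear_pair X U V (f : {linear X -> U}) (g : {linear X -> V}) :
  exists h : {linear X -> (U * V)%type}, forall x, h x = (f x, g x).
Proof.
have [|h hE] := @linear_packP X (U * V)%type (fun x => (f x, g x)).
  by move=> a x y /=; rewrite !linearP.
by exists h.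
Qed.

End LinearMaps.

(** * Direct sums, traces and sigma[M] *)

Section Sigma.
Variable A : pzRingType.
Implicit Types G L M Q T X Y : lmodType A.

(** The universal property of the direct sum. It is tested on families
    supported at one index, which generate the direct sum. *)
Lemma dsum_lift (I : Type) M G (f : I -> {linear M -> G}) :
  exists p : {linear dsum I M -> G},
    forall u i, (forall j, j <> i -> val u j = 0) -> p u = f i (val u i).
Proof.
pose J : choiceType := {classic I}.
pose s (u : dsum I M) := \sum_(i \in [set: J]) f i (val u i).
(* Independence of the finite set of indices gives additivity. *)
have sE u (r : seq J) : uniq r -> (forall j, val u j <> 0 -> j \in r) ->
    s u = \sum_(i <- r) f i (val u i).
  move=> r_uniq u_r; rewrite /s (@fsbigE _ _ _ J _ r) //.
    by apply: eq_bigl => i; rewrite in_setT.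
  move=> i _ ir; have [->|/u_r ri] := pselect (val u i = 0); first exact: linear0.
  by rewrite ri in ir.
have cover (u : dsum I M) : exists r : seq J, forall j, val u j <> 0 -> j \in r.
  have /asboolP/(@finite_seqP J)[r ur] := valP u.
  exists r => j uj.
  by have : [set` r]%classic j by rewrite -ur.
have [|p pE] := @linear_packP A (dsum I M) G s.
  move=> a u v; have [r ru] := cover u; have [t tv] := cover v.
  have uniq_rt : uniq (undup (r ++ t)) by apply: undup_uniq.
  rewrite !(sE _ _ uniq_rt).
  - rewrite scaler_sumr -big_split; apply: eq_bigr => i _.
    by rewrite -[LHS]/(f i (a *: val u i + val v i)) linearP.
  - by move=> j /tv; rewrite mem_undup mem_cat => ->; rewrite orbT.
  - by move=> j /ru; rewrite mem_undup mem_cat => ->.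
  - move=> j uvj; rewrite mem_undup mem_cat; apply/orP.
    have [uj|/ru] := pselect (val u j = 0); last by left.
    right; apply: tv => vj; apply: uvj.
    by rewrite -[LHS]/(a *: val u j + val v j) uj vj scaler0 addr0.
exists p => u i ui; rewrite pE (sE _ [:: i]) ?big_seq1 //.
move=> j uj; rewrite inE; apply/eqP; apply: contrapT => ji.
by exact: uj (ui _ _).
Qed.

Lemma dsum_single (I : Type) M (i : I) :
  exists e : {linear M -> dsum I M},
    (forall m, val (e m) i = m) /\ forall m j, j <> i -> val (e m) j = 0.
Proof.
pose e (m : M) : I -> M := fun j => if `[< j = i >] then m else 0.
have eS m : e m \in @fin_supp A I M.
  apply/asboolP; apply: (@sub_finite_set _ _ [set i]%classic) (finite_set1 i).
  by move=> j /=; rewrite /e; case: asboolP.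
have [|f fE] := @linear_packP A M (dsum I M) (fun m => Submod (eS m)).
  move=> a x y; apply: val_inj; apply/funext => j.
  rewrite -[RHS]/(a *: e x j + e y j) /= /e.
  by case: (asboolP (j = i)); rewrite ?scaler0 ?addr0.
by exists f; split=> [m|m j ji]; rewrite fE /= /e; case: asboolP.
Qed.

Lemma trace_lin M L (h : {linear M -> L}) m : h m \in trace M L.
Proof. by apply/asboolP; exists [:: (h, m)]; rewrite big_seq1. Qed.

Lemma trace_morph M L X (h : {linear L -> X}) x :
  x \in trace M L -> h x \in trace M X.
Proof. by move=> Lx; have := valP (trace_map M h (Submod Lx)). Qed.

Lemma dsum_trace (I : Type) M (u : dsum I M) : u \in trace M (dsum I M).
Proof.
pose J : choiceType := {classic I}.
have /asboolP/(@finite_seqP J)[r ur] := valP u.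
have {ur} : forall j : J, val u j <> 0 -> j \in r.
  by move=> j uj; have : [set` r]%classic j by rewrite -ur.
elim: r u => [|i r IH] u ur.
  have -> : u = 0.
    apply: val_inj; apply/funext => j; apply: contrapT => uj.
    by have := ur j uj.
  exact: rpred0.
have [e [e1 e0]] := @dsum_single I M i.
rewrite -[u](subrK (e (val u i))) rpredD ?trace_lin // IH // => j.
rewrite -[val _ j]/(val u j - val (e (val u i)) j).
have [->|ji] := pselect (j = i); first by rewrite e1 subrr.
rewrite e0 // subr0 => /ur; rewrite inE => /orP[/eqP|//].
by move/ji.
Qed.

(** The trace is the largest M-generated submodule; for the backward direction
    one copy of M is taken for each map M -> G. Membership in the trace is
    easier to transport along maps than a surjection from a direct sum. *)
Lemma generated_byP M G : generated_by M G <-> forall x, x \in trace M G.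
Proof.
split=> [[I [p p_surj]] x|Gtr].
  by have [u <-] := p_surj x; apply: trace_morph; apply: dsum_trace.
have [p pE] := dsum_lift (fun f : {linear M -> G} => f).
exists {linear M -> G}, p => x.
have /asboolP[s ->] := Gtr x.
elim: s => [|[f m] s [u IH]]; first by exists 0; rewrite linear0 big_nil.
have [e [e1 e0]] := @dsum_single {linear M -> G} M f.
exists (e m + u); rewrite linearD IH big_cons /=; congr (_ + _).
by rewrite (pE _ f) ?e1 // => j; apply: e0.
Qed.

Lemma generated_sigma M G : generated_by M G -> sigma M G.
Proof. by move=> MG; exists G, idfun; split=> // x y. Qed.

Lemma sigma_sub M X Y (j : {linear X -> Y}) : injective j -> sigma M Y -> sigma M X.
Proof.
move=> j_inj [G [k [MG k_inj]]]; exists G, (k \o j); split=> //.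
exact: inj_comp.
Qed.

Lemma sigma_prod M X Y : sigma M X -> sigma M Y -> sigma M (X * Y)%type.
Proof.
move=> [G [j [/generated_byP MG j_inj]]] [H [k [/generated_byP MH k_inj]]].
have [h hE] := linear_pair (j \o fst : {linear (X * Y)%type -> G})
  (k \o snd : {linear (X * Y)%type -> H}).
exists (G * H)%type, h; split; last first.
  by move=> [x y] [x' y']; rewrite !hE /= => -[/j_inj -> /k_inj ->].
apply/generated_byP => -[x y].
have [inl inlE] := linear_pair idfun (\0 : {linear G -> H}).
have [inr inrE] := linear_pair (\0 : {linear H -> G}) idfun.
have -> : (x, y) = inl x + inr y.
  by rewrite inlE inrE -[RHS]/(x + 0, 0 + y) addr0 add0r.
by rewrite rpredD // trace_morph.
Qed.

Lemma sigma_trace_submod M L : sigma M (submod (trace M L)).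
Proof.
apply/generated_sigma/generated_byP => -[x Lx].
have /asboolP[s xE] := Lx; apply/asboolP.
have lift (h : {linear M -> L}) :
    exists g : {linear M -> submod (trace M L)}, forall m, val (g m) = h m.
  by apply: corestrict => m; apply: trace_lin.
have {lift}[g gE] := choice lift.
exists [seq (g p.1, p.2) | p <- s].
apply: val_inj; rewrite big_map raddf_sum /= xE.
by apply: eq_bigr => p _; rewrite gE.
Qed.

(** X embeds into an M-generated module, to which f extends since Q is
    injective; the image of an M-generated module lies in the trace. *)
Lemma sigma_lin_trace M X Q (f : {linear X -> Q}) :
  injective_in (@all_modules A) Q -> sigma M X -> forall x, f x \in trace M Q.
Proof.
move=> [_ Qinj] [G [j [/generated_byP MG j_inj]]] x.
have [//|//|g gE] := Qinj X G j f _ _ j_inj.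
by rewrite -gE trace_morph.
Qed.

Lemma trace_injective M Q :
  injective_in (@all_modules A) Q -> injective_in (sigma M) (submod (trace M Q)).
Proof.
move=> Qinj; split=> [|X Y i f _ MY i_inj]; first exact: sigma_trace_submod.
have [_ /(_ X Y i (val \o f) Logic.I Logic.I i_inj)[g gE]] := Qinj.
have [h hE] := corestrict (sigma_lin_trace g Qinj MY).
by exists h => x; apply: val_inj; rewrite hE gE.
Qed.

(** * Powers in a full subcategory *)

Lemma power_in_self (C : lmodType A -> Prop) T (I : Type) :
  C (I -> T) -> exists p : I -> {linear (I -> T) -> T},
    (forall i u, p i u = u i) /\ is_power_in C p.
Proof.
move=> CT; have [p pE] := choice (@fct_proj A T I).
exists p; split=> //; split=> // Y f CY.
have [g gE] := fct_lin f; exists g; split=> [i y|h hE y].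
  by rewrite pE gE.
by apply/funext => i; rewrite gE -hE pE.
Qed.

Lemma cogen_in_self (C : lmodType A -> Prop) T : C T -> cogen_in C T T.
Proof.
move=> CT; split=> //; exists unit, T, (fun=> idfun); split; last by exists idfun.
split=> // Y f CY; exists (f tt); split=> [[]//|h hE y].
exact: hE tt y.
Qed.

(** A power of T in C is isomorphic to the power of T in all modules as soon as
    the latter lies in C; an injection is enough here. *)
Lemma cogen_inP (C : lmodType A -> Prop) T X :
  (forall I : Type, C (I -> T)) -> cogen_in C T X <-> C X /\ Cogen T X.
Proof.
move=> CT; split=> [[CX [I [P [p [[CP Pp] [j j_inj]]]]]]|[CX [I [j j_inj]]]].
  split=> //; have [k kE] := fct_lin p.
  have [q [qE _]] := power_in_self (CT I).
  have [g [gE _]] := Pp _ q (CT I).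
  have [h [_ h_uniq]] := Pp _ p CP.
  (* Both g \o k and the identity commute with the projections of P. *)
  have gk x : g (k x) = x.
    transitivity (h x); last by apply/esym/(h_uniq idfun).
    by apply: (h_uniq (g \o k)) => i y; rewrite /= gE qE kE.
  exists I, (k \o j); apply: inj_comp j_inj.
  exact: can_inj gk.
split=> //; have [p [_ pP]] := power_in_self (CT I).
by exists I, (I -> T), p; split=> //; exists j.
Qed.

End Sigma.

(** * Extensions by the kernel of a map of injectives *)

Section Coresolution.
Variables (A : pzRingType) (Q0 Q1 : lmodType A) (z : {linear Q0 -> Q1}).
Hypothesis Q0_inj : injective_in (@all_modules A) Q0.
Hypothesis Q1_inj : injective_in (@all_modules A) Q1.
Let T : lmodType A := submod (lin_ker z).
Implicit Types M X Y : lmodType A.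

(** Extend T -> Q0 to h on the middle term E. The map z h kills T, so it comes
    from X, and it lifts to some f : X -> Q0. Then h - f e takes values in the
    kernel T of z and restricts to the identity of T: the extension splits. *)
Lemma Bclass_Ext1_eq0 (C : lmodType A -> Prop) X : Bclass z X -> Ext1_eq0 C X T.
Proof.
move=> BX [E i e iex] _ /=; have [i_inj ie e_surj] := iex.
have [_ /(_ T E i val Logic.I Logic.I i_inj)[h hE]] := Q0_inj.
have [u|g gE] := @factor_surjection _ _ _ _ e (z \o h) e_surj.
  by move/ie=> [t <-] /=; rewrite hE; apply/eqP/(valP t).
have [f fE] := BX g.
have [|r rE] := @corestrict _ E Q0 (lin_ker z) (h \- (f \o e)).
  move=> u; apply/eqP.
  by rewrite /= linearB fE gE subrr.
have [phi phiE] := linear_pair r e.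
exists phi; split=> [t|u]; rewrite phiE //=.
have et : e (i t) = 0 by apply/ie; exists t.
rewrite /split_in et; congr pair; apply: val_inj; rewrite rE.
by rewrite /= hE et linear0 subr0.
Qed.

(** The pullback of the coresolution along g : X -> Q1 is an extension of X by T
    in sigma[M]; subtracting a retraction onto T from its projection to Q0
    gives a map that kills T, hence factors through X, and lifts g. *)
Lemma Ext1_eq0_Bclass M X : trace_coresolution M z -> sigma M X ->
  Ext1_eq0 (sigma M) X T -> Bclass z X.
Proof.
move=> [_ _ [i [iE [_ _ tr_surj]]]] MX ExtX g.
(* E is the pullback of g along the trace map; it fits in 0 -> T -> E -> X -> 0. *)
pose d : {linear (submod (trace M Q0) * X)%type -> Q1} :=
  (z \o (val \o fst)) \- (g \o snd).
pose E : lmodType A := submod (lin_ker d).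
have dE q x : (q, x) \in lin_ker d <-> z (val q) = g x.
  by split=> [/eqP/subr0_eq|e] //; apply/eqP; rewrite /= e subrr.
have [inl inlE] := linear_pair i (\0 : {linear T -> X}).
have zT (t : T) : z (val t) = 0 by apply/eqP/(valP t).
have [|e_in e_inE] := @corestrict A T _ (lin_ker d) inl.
  by move=> t; rewrite inlE; apply/dE; rewrite iE zT linear0.
have [//|e_out e_outE] := @linear_packP A E X (fun u => (val u).2).
have e_exact : short_exact e_in e_out.
  split=> [t t' /(congr1 val)|[[q x] Sqx]|x].
  - rewrite !e_inE /= !inlE => -[/(congr1 val)].
    by rewrite !iE => /val_inj.
  - rewrite e_outE /=; split=> [x0|[t /(congr1 val)]]; last first.
      by rewrite e_inE /= inlE => -[].
    have q0 : val q \in lin_ker z.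
      by apply/eqP; rewrite (iffLR (dE q x)) // x0 linear0.
    exists (Submod q0); apply: val_inj; rewrite e_inE /= inlE x0.
    by congr pair; apply: val_inj; rewrite iE.
  - have [q qE] := tr_surj (Submod (sigma_lin_trace g Q1_inj MX x)).
    have Sqx : (q, x) \in lin_ker d by apply/dE; have /(congr1 val) := qE.
    by exists (Submod Sqx); rewrite e_outE.
have ME : sigma M E.
  have val_inj' : injective (val : E -> _) by apply: val_inj.
  exact: sigma_sub val_inj' (sigma_prod (sigma_trace_submod M Q0) MX).
have [phi [phi_in phi_out]] := ExtX (Extension e_exact) ME.
have [h hE] : exists h : {linear E -> Q0},
    forall u, h u = val (val u).1 - val (phi u).1.
  have [|h hE] := @linear_packP A E Q0 (fun u => val (val u).1 - val (phi u).1).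
    by move=> a u v; rewrite !linearP /= addrACA -scalerDr.
  by exists h.
have [_ e_ker e_surj] := e_exact.
have [|f fE] := factor_surjection e_surj (h := h).
  move=> u /e_ker[t <-]; have /= -> := hE; rewrite phi_in /= e_inE /= inlE /=.
  by rewrite iE subrr.
exists f => x; have [u <-] := e_surj x.
rewrite fE hE linearB zT subr0 e_outE.
by case: u => -[q x'] Sqx; apply/dE.
Qed.

End Coresolution.

(** * Modules killed by a left ideal *)

Section Killed.
Variables (A : pzRingType) (I : submodClosed A^o).
Implicit Types X Y T : lmodType A.

Definition killed X := forall (a : A^o) (x : X), a \in I -> (a : A) *: x = 0.

(** For x in X the map a |-> a x factors through A/I. *)
Lemma killed_sigma X : killed X -> sigma (quotmod I) X.
Proof.
move=> IX; apply/generated_sigma/generated_byP => x.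
have [p [p_surj p_ker]] := quotmod_pi_lin I.
have [f fE] := orbit_lin x.
have [|g gE] := factor_surjection p_surj (h := f).
  by move=> a /p_ker Ia; rewrite fE IX.
have -> : x = g (p 1) by rewrite gE fE scale1r.
exact: trace_lin.
Qed.

Lemma killed_fct T (J : Type) : killed T -> killed (J -> T).
Proof. by move=> IT a u Ia; apply/funext => j; exact: IT. Qed.

Lemma killed_Cogen T X : killed T -> Cogen T X -> killed X.
Proof.
move=> IT [J [j j_inj]] a x Ia; apply: j_inj.
by rewrite linear0 linearZ; exact: killed_fct.
Qed.

(** The maps a |-> a x, restricted to I, are zero. *)
Lemma killed_of_hom0 X :
  (forall (f : {linear submod I -> X}) x, f x = 0) -> killed X.
Proof.
move=> I0 a x Ia; have [f fE] := orbit_lin x.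
by have := I0 (f \o val) (Submod Ia); rewrite /= fE.
Qed.

End Killed.

Section Annihilator.
Variables (A : pzRingType) (T : lmodType A).

Definition ann : {pred A^o} := fun a => `[< forall t : T, (a : A) *: t = 0 >].

Lemma ann_closed : submod_closed ann.
Proof.
split=> [|a b c /asboolP b0 /asboolP c0]; apply/asboolP => t.
  exact: scale0r.
by rewrite scalerDl -scalerA b0 c0 scaler0 addr0.
Qed.

HB.instance Definition _ :=
  GRing.isSubmodClosed.Build A A^o ann ann_closed.

Lemma killed_ann : killed ann T.
Proof. by move=> a t /asboolP. Qed.

(** The map a |-> (a t)_t embeds A/ann(T) into the power T^T. *)
Lemma Cogen_quotmod_ann : Cogen T (quotmod ann).
Proof.
have [p [p_surj p_ker]] := quotmod_pi_lin ann.
have [f fE] := choice (@orbit_lin A T).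
have [g gE] := fct_lin f.
have [|h hE] := factor_surjection p_surj (h := g).
  by move=> a /p_ker /asboolP a0; apply/funext => t; rewrite gE fE a0.
exists T, h => u v; have [a <-] := p_surj u; have [b <-] := p_surj v.
rewrite !hE => gab; apply/eqP; rewrite -subr_eq0 -linearB; apply/eqP/p_ker.
apply/asboolP => t; rewrite scalerBl -!fE -!gE gab.
exact: subrr.
Qed.

End Annihilator.

(** * Cotilting versus cosilting *)

Section Core.
Variables (A : pzRingType) (Q0 Q1 : lmodType A) (z : {linear Q0 -> Q1}).
Hypothesis Q0_inj : injective_in (@all_modules A) Q0.
Hypothesis Q1_inj : injective_in (@all_modules A) Q1.
Let T : lmodType A := submod (lin_ker z).
Implicit Types X Y : lmodType A.

Lemma cotilting_iff_cosilting (I : submodClosed A^o) :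
  killed I T -> (forall X, Bclass z X -> killed I X) ->
  trace_coresolution (quotmod I) z ->
  cotilting_in (sigma (quotmod I)) T <-> forall X, Cogen T X <-> Bclass z X.
Proof.
move=> IT IB cores; pose C := sigma (quotmod I).
have cogenE X : cogen_in C T X <-> Cogen T X.
  rewrite cogen_inP => [|J]; last exact/killed_sigma/killed_fct.
  by split=> [[]//|TX]; split=> //; apply/killed_sigma/killed_Cogen/TX.
have extE X : C X /\ Ext1_eq0 C X T <-> Bclass z X.
  split=> [[CX]|BX]; first exact: Ext1_eq0_Bclass.
  by split; [apply/killed_sigma/IB | exact: Bclass_Ext1_eq0].
split=> [[_ cot] X|TB]; first by rewrite -cogenE cot extE.
by split=> [|X]; [exact: killed_sigma | rewrite cogenE TB extE].
Qed.

(** An element of the trace of M in Q1 is a sum of values of maps M -> Q1, and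
    each of these maps lifts along z. *)
Lemma trace_coresolution_of_Bclass M : sigma M T -> Bclass z M ->
  trace_coresolution M z.
Proof.
move=> MT BM; split; try exact: trace_injective.
have [i iE] := corestrict (f := val : {linear T -> Q0})
  (fun t => sigma_lin_trace (val : {linear T -> Q0}) Q0_inj MT t).
exists i; split=> //; split=> [t t' /(congr1 val)|q|[y My]].
- by rewrite !iE => /val_inj.
- split=> [/(congr1 val) /= q0|[t <-]].
    have Tq : val q \in lin_ker z by apply/eqP.
    by exists (Submod Tq); apply: val_inj; rewrite iE.
  by apply: val_inj => /=; rewrite iE; apply/eqP/(valP t).
have /asboolP[s yE] := My.
have [x [Mx zx]] : exists x, x \in trace M Q0 /\ z x = y.
  rewrite {}yE; elim: s {My} => [|[g m] s [x [Mx zx]]].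
    by exists 0; rewrite linear0 big_nil rpred0.
  have [f fE] := BM g; exists (f m + x).
  by rewrite rpredD ?trace_lin // linearD fE zx big_cons.
by exists (Submod Mx); apply: val_inj.
Qed.

Let I : submodClosed A^o := ann T.

(** A map f : I -> T extends to h : A -> Q0. The map z h kills I, so it comes from
    A/I and lifts to k : A/I -> Q0. Then e = h - k p is a map A -> T extending
    f, and e(a) = a e(1) is zero for a in I since I annihilates T. *)
Lemma hom_ann_eq0 : Bclass z (quotmod I) ->
  forall (f : {linear submod I -> T}) x, f x = 0.
Proof.
move=> BI f x; have [p [p_surj p_ker]] := quotmod_pi_lin I.
have val_inj' : injective (val : submod I -> A^o) by apply: val_inj.
have [_ /(_ _ A^o val (val \o f) Logic.I Logic.I val_inj')[h hE]] := Q0_inj.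
have [a|g gE] := factor_surjection p_surj (h := z \o h).
  move/p_ker => Ia; have /= -> := hE (Submod Ia).
  by apply/eqP/(valP (f (Submod Ia))).
have [k kE] := BI g.
have [a|e eE] := @corestrict _ A^o Q0 (lin_ker z) (h \- (k \o p)).
  by apply/eqP; rewrite /= linearB kE gE subrr.
have -> : f x = e (val x).
  apply: val_inj; rewrite eE /= hE.
  have /p_ker -> := valP x.
  by rewrite linear0 subr0.
have /asboolP x0 := valP x.
rewrite -[val x]mulr1.
by rewrite -[_ * _]/((val x : A) *: (1 : A^o)) linearZ /= x0.
Qed.

End Core.

Theorem theorem1p1 (R : pzRingType) (Q0 Q1 : lmodType R^c)
    (zeta : {linear Q0 -> Q1})
    (Q0_inj : injective_in (@all_modules R^c) Q0)
    (Q1_inj : injective_in (@all_modules R^c) Q1) :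
  let T : lmodType R^c := submod (lin_ker zeta) in
  cosilting zeta T <->
  exists I : submodClosed (R^c)^o,
    [/\ cotilting_in (sigma (quotmod I)) T /\
          trace_coresolution (quotmod I) zeta,
        Ext1_eq0 (sigma (quotmod I)) (quotmod I) T
      & forall Y : lmodType R^c, Bclass zeta Y ->
          forall f : {linear submod I -> Y}, forall x, f x = 0].
Proof.
move=> T; split=> [[_ _ _ TB]|[I [[cot cores] _ hom0]]].
  pose I : submodClosed (R^c)^o := ann T.
  have BI : Bclass zeta (quotmod I) by apply/TB/Cogen_quotmod_ann.
  have MT : sigma (quotmod I) T by apply/killed_sigma/killed_ann.
  have cores := trace_coresolution_of_Bclass Q0_inj Q1_inj MT BI.
  exists I; split; [split=> // | exact: Bclass_Ext1_eq0 |].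
    apply/cotilting_iff_cosilting => // [|X /TB].
      exact: killed_ann.
    exact/killed_Cogen/killed_ann.
  move=> Y /TB[J [j j_inj]] f x; apply: j_inj; rewrite linear0.
  apply/funext => i; have [p pE] := @fct_proj _ T J i.
  by have := hom_ann_eq0 Q0_inj BI (p \o j \o f) x; rewrite /= pE.
have IB X : Bclass zeta X -> killed I X by move/hom0/killed_of_hom0.
have BT : Bclass zeta T.
  have /cogen_in_self/cot.2[MT ExtT] := cot.1.
  exact: Ext1_eq0_Bclass cores MT ExtT.
split=> //; last first.
  exact/(cotilting_iff_cosilting Q0_inj Q1_inj (IB _ BT) IB cores).
exists val; split; first exact: val_inj.
move=> q; split=> [q0|[t <-]]; last by apply/eqP/(valP t).
have Tq : q \in lin_ker zeta by apply/eqP.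
by exists (Submod Tq).
Qed.
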